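(* Consider, in the absence of mass source, the semidiscrete system $$\sigma_i\frac{\rm d}{{\rm d}t}(\theta_i h_i)+\sum_{j\in\mathcal N(i)}l_{(i,j)}\,\theta h_{(i,j)}\,(v_n)_{(i,j)}=0,$$ $$\sigma_i\frac{\rm d}{{\rm d}t}(\theta_i h_i v_{a\,i})+\sum_{j\in\mathcal N(i)}l_{(i,j)}\,\theta h_{(i,j)}\,(v_a)_{(i,j)}(v_n)_{(i,j)}+\frac12\sum_{j\in\mathcal N(i)}l_{(i,j)}(w_j-w_i)\,\theta h^s_{(i,j)}\,(n_a)_{(i,j)}=-\sigma_i\mathcal K_i|\boldsymbol v_i|v_{a\,i},\quad a=1,2,$$ $i=1,\dots,N$. Let $w\in\mathbb R$ be a constant. (a) Regular stationary point: a state with $h_i>0$, $w_i=w$ and $\boldsymbol v_i=0$ for all $i=1,\dots,N$ is a stationary point of the system. (b) Singular stationary point: a state with $\boldsymbol v_i=0$ for all $i=1,\dots,N$ such that, for some $\mathcal I\subset\{1,\dots,N\}$, $w_i=w$ for all $i\in\mathcal I$, and $h_i=0$, $g z_i>w$ for all $i\in\{1,\dots,N\}\setminus\mathcal I$, is a stationary point of the system.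
   Context: $\Omega\subset\mathbb R^2$ is partitioned into polygons $\omega_i$, $i=1,\dots,N$; $\sigma_i>0$ is the area of $\omega_i$; $\mathcal N(i)\subset\{1,\dots,N\}$ is the set of neighbours of $\omega_i$ (cells sharing a side with it; sides on $\partial\Omega$ contribute no terms); $l_{(i,j)}$ is the length of the common side of $\omega_i,\omega_j$ and $\boldsymbol n_{(i,j)}$ (components $(n_a)_{(i,j)}$) its unit normal pointing towards $\omega_j$. Each cell carries a water depth $h_i\ge0$, a velocity $\boldsymbol v_i=(v_{1\,i},v_{2\,i})\in\mathbb R^2$, a porosity $\theta_i\in(0,1]$ and a soil altitude $z_i$. $g>0$ is the gravitational acceleration, $w_i=g(z_i+h_i)$ is the free surface level, $\mathcal K_i=\alpha_p h_i(1-\theta_i)+\theta_i\alpha_s$ with constants $\alpha_p,\alpha_s$. Interface values: $\boldsymbol v_{(i,j)}=(\boldsymbol v_i+\boldsymbol v_j)/2$ with components $(v_a)_{(i,j)}$; $(v_n)_{(i,j)}=\boldsymbol v_{(i,j)}\cdot\boldsymbol n_{(i,j)}$; $\theta h_{(i,j)}=\theta_ih_i$ if $(v_n)_{(i,j)}>0$ and $\theta h_{(i,j)}=\theta_jh_j$ if $(v_n)_{(i,j)}<0$ (when $(v_n)_{(i,j)}=0$, the products $\theta h_{(i,j)}(v_n)_{(i,j)}$ are $0$); $\theta h^s_{(i,j)}=\theta h_{(i,j)}$ if $(v_n)_{(i,j)}\neq0$; $=\theta_ih_i$ if $(v_n)_{(i,j)}=0$ and $w_i>w_j$; $=\theta_jh_j$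 if $(v_n)_{(i,j)}=0$ and $w_i\le w_j$. A state is a stationary point if, as a time-independent function, it satisfies the system. *)

(* Defs.v *)
From HB Require Import structures.
From mathcomp Require Import all_boot all_order all_algebra.
From mathcomp Require Import all_classical all_reals all_analysis.
Set Implicit Arguments.
Unset Strict Implicit.
Unset Printing Implicit Defensive.
Import Order.TTheory GRing.Theory Num.Theory.
Import numFieldNormedType.Exports.
Local Open Scope classical_set_scope.
Local Open Scope ring_scope.

Definition dot (R : realType) (u v : 'rV[R]_2) : R :=
  \sum_(a < 2) u ord0 a * v ord0 a.

(* The library norm `|u| on 'rV[R]_2 is the sup norm, not the Euclidean one. *)
Definition enorm (R : realType) (u : 'rV[R]_2) : R := Num.sqrt (dot u u).

(** * Polygonal meshes *)

Definition frontier (T : topologicalType) (A : set T) : set T :=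
  closure A `\` interior A.

Definition point2 (R : realType) (p : R * R) : 'rV[R]_2 :=
  \row_(a < 2) (if a == ord0 then p.1 else p.2).

(* The two-dimensional Lebesgue measure lives on R * R. *)
Definition area (R : realType) (A : set 'rV[R]_2) : R :=
  fine ((@lebesgue_measure R \x @lebesgue_measure R)%E (@point2 R @^-1` A)).

Definition segment (R : realType) (s : 'rV[R]_2 * 'rV[R]_2) : set 'rV[R]_2 :=
  [set s.1 + t *: (s.2 - s.1) | t in [set t : R | 0 <= t <= 1]].

Definition segment_co (R : realType) (s : 'rV[R]_2 * 'rV[R]_2) :
    set 'rV[R]_2 :=
  [set s.1 + t *: (s.2 - s.1) | t in [set t : R | 0 <= t < 1]].

Definition sides (R : realType) (p : seq 'rV[R]_2) :
    seq ('rV[R]_2 * 'rV[R]_2) := zip p (rot 1 p).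

(* A closed polygonal line is simple when its half-open sides are pairwise
   disjoint. Straight angles are allowed, so that a point of a straight edge may
   be declared a vertex. *)
Definition simple_polygonal_line (R : realType) (p : seq 'rV[R]_2) : Prop :=
  [/\ (2 < size p)%N, uniq p &
      forall s1 s2, s1 \in sides p -> s2 \in sides p -> s1 != s2 ->
        segment_co s1 `&` segment_co s2 = set0].

(* By the Jordan curve theorem, the interior of a simple closed curve is the only
   bounded open set whose frontier is this curve. *)
Definition polygon (R : realType) (p : seq 'rV[R]_2) (A : set 'rV[R]_2) : Prop :=
  [/\ simple_polygonal_line p, open A, bounded_set A &
      frontier A = [set x | exists2 s, s \in sides p & segment s x]].

(* s, oriented as in the first polygon, is a side of both polygons, and it is
   not a piece of the boundary of Omega. *)
Definition is_common_side (R : realType) (Omega : set 'rV[R]_2)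
    (p q : seq 'rV[R]_2) (s : 'rV[R]_2 * 'rV[R]_2) : Prop :=
  [/\ s \in sides p, (s \in sides q) || ((s.2, s.1) \in sides q) &
      ~ (segment s `<=` frontier Omega)].

Record mesh (R : realType) := Mesh {
  domain : set 'rV[R]_2 ;
  ncells : nat ;
  vertices : 'I_ncells -> seq 'rV[R]_2 ;
  cell : 'I_ncells -> set 'rV[R]_2 ;
  cell_polygon : forall i, polygon (vertices i) (cell i) ;
  cell_disjoint : forall i j, i != j -> cell i `&` cell j = set0 ;
  cell_domain : forall i, cell i `<=` domain ;
  domain_cover : domain `<=` \bigcup_(i in [set: 'I_ncells]) closure (cell i) ;
  (* needed to speak of "the" common side of two neighbours *)
  common_side_uniq : forall i j s s', i != j ->
    is_common_side domain (vertices i) (vertices j) s ->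
    is_common_side domain (vertices i) (vertices j) s' -> s = s' }.

Definition cell_area (R : realType) (M : mesh R) (i : 'I_(ncells M)) : R :=
  area (cell i).

Definition neighbours (R : realType) (M : mesh R) (i : 'I_(ncells M)) :
    {set 'I_(ncells M)} :=
  [set j | (j != i) &&
    `[< exists s, is_common_side (domain M) (vertices i) (vertices j) s >]]%SET.

Definition common_side (R : realType) (M : mesh R) (i j : 'I_(ncells M)) :
    'rV[R]_2 * 'rV[R]_2 :=
  xget (0, 0)
    [set s | is_common_side (domain M) (vertices i) (vertices j) s].

Definition side_length (R : realType) (M : mesh R) (i j : 'I_(ncells M)) : R :=
  enorm ((common_side i j).2 - (common_side i j).1).

Definition midpoint (R : realType) (s : 'rV[R]_2 * 'rV[R]_2) : 'rV[R]_2 :=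
  2^-1 *: (s.1 + s.2).

Definition is_unit_normal_towards (R : realType) (s : 'rV[R]_2 * 'rV[R]_2)
    (A : set 'rV[R]_2) (n : 'rV[R]_2) : Prop :=
  [/\ enorm n = 1, dot n (s.2 - s.1) = 0 &
      \forall e \near 0^'+, A (midpoint s + e *: n)].

Definition side_normal (R : realType) (M : mesh R) (i j : 'I_(ncells M)) :
    'rV[R]_2 :=
  xget 0 [set n | is_unit_normal_towards (common_side i j) (cell j) n].

(** * The semidiscrete system *)

Record parameters (R : realType) (M : mesh R) := MkParams {
  gravity : R ;
  alpha_p : R ;
  alpha_s : R ;
  porosity : 'I_(ncells M) -> R ;
  altitude : 'I_(ncells M) -> R ;
  gravity_gt0 : 0 < gravity ;
  porosity_itv : forall i, 0 < porosity i <= 1 }.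

Record state (R : realType) (M : mesh R) := State {
  depth : 'I_(ncells M) -> R ;
  velocity : 'I_(ncells M) -> 'rV[R]_2 ;
  depth_ge0 : forall i, 0 <= depth i }.

Definition free_surface (R : realType) (M : mesh R) (P : parameters M)
    (U : state M) (i : 'I_(ncells M)) : R :=
  gravity P * (altitude P i + depth U i).

Definition friction (R : realType) (M : mesh R) (P : parameters M)
    (U : state M) (i : 'I_(ncells M)) : R :=
  alpha_p P * depth U i * (1 - porosity P i) + porosity P i * alpha_s P.

Definition water (R : realType) (M : mesh R) (P : parameters M)
    (U : state M) (i : 'I_(ncells M)) : R :=
  porosity P i * depth U i.

Definition itf_velocity (R : realType) (M : mesh R) (U : state M)
    (i j : 'I_(ncells M)) : 'rV[R]_2 :=
  2^-1 *: (velocity U i + velocity U j).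

Definition itf_normal_velocity (R : realType) (M : mesh R) (U : state M)
    (i j : 'I_(ncells M)) : R :=
  dot (itf_velocity U i j) (side_normal i j).

(* The last value is irrelevant: itf_water only occurs multiplied by
   itf_normal_velocity. *)
Definition itf_water (R : realType) (M : mesh R) (P : parameters M)
    (U : state M) (i j : 'I_(ncells M)) : R :=
  if 0 < itf_normal_velocity U i j then water P U i
  else if itf_normal_velocity U i j < 0 then water P U j
  else 0.

Definition itf_water_s (R : realType) (M : mesh R) (P : parameters M)
    (U : state M) (i j : 'I_(ncells M)) : R :=
  if itf_normal_velocity U i j != 0 then itf_water P U i j
  else if free_surface P U j < free_surface P U i then water P U i
  else water P U j.

Definition mass_flux (R : realType) (M : mesh R) (P : parameters M)
    (U : state M) (i : 'I_(ncells M)) : R :=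
  \sum_(j in neighbours i)
    side_length i j * itf_water P U i j * itf_normal_velocity U i j.

Definition momentum_flux (R : realType) (M : mesh R) (P : parameters M)
    (U : state M) (i : 'I_(ncells M)) (a : 'I_2) : R :=
  \sum_(j in neighbours i)
    side_length i j * itf_water P U i j * itf_velocity U i j ord0 a
    * itf_normal_velocity U i j.

Definition surface_gradient (R : realType) (M : mesh R) (P : parameters M)
    (U : state M) (i : 'I_(ncells M)) (a : 'I_2) : R :=
  2^-1 * \sum_(j in neighbours i)
    side_length i j * (free_surface P U j - free_surface P U i)
    * itf_water_s P U i j * side_normal i j ord0 a.

Definition solves (R : realType) (M : mesh R) (P : parameters M)
    (U : R -> state M) : Prop :=
  forall (t : R) (i : 'I_(ncells M)),
    (derivable (fun s => water P (U s) i) t 1 /\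
     cell_area i * derive1 (fun s => water P (U s) i) t
       + mass_flux P (U t) i = 0) /\
    forall a : 'I_2,
      derivable (fun s => water P (U s) i * velocity (U s) i ord0 a) t 1 /\
      cell_area i * derive1 (fun s => water P (U s) i * velocity (U s) i ord0 a) t
        + momentum_flux P (U t) i a + surface_gradient P (U t) i a
      = - (cell_area i * friction P (U t) i * enorm (velocity (U t) i)
           * velocity (U t) i ord0 a).

Definition stationary_point (R : realType) (M : mesh R) (P : parameters M)
    (U : state M) : Prop := solves P (fun _ : R => U).

(* Main.v *)
(* At rest, every time derivative, flux and friction term vanishes, so only the
   discrete surface gradient matters. Its water content is taken from the cell
   with the higher free surface; hence it vanishes as soon as every cell lying
   strictly above another one is dry. *)
Require Import Defs.
From mathcomp Require Import all_boot all_order all_algebra.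
From mathcomp Require Import all_classical all_reals all_analysis.
Import Order.TTheory GRing.Theory Num.Theory.
Local Open Scope ring_scope.

Lemma itf_normal_velocity_rest (R : realType) (M : mesh R) (U : state M) i j :
  (forall k, velocity U k = 0) -> itf_normal_velocity U i j = 0.
Proof.
move=> v0; rewrite /itf_normal_velocity /itf_velocity !v0 addr0 scaler0 /dot.
by rewrite big1 // => a _; rewrite mxE mul0r.
Qed.

Lemma surface_gradient_rest (R : realType) (M : mesh R) (P : parameters M)
    (U : state M) i a :
  (forall k, velocity U k = 0) ->
  (forall k l, free_surface P U l < free_surface P U k -> depth U k = 0) ->
  surface_gradient P U i a = 0.
Proof.
move=> v0 dry; rewrite /surface_gradient big1 ?mulr0 // => j _.
rewrite /itf_water_s itf_normal_velocity_rest // eqxx /= /water.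
(* If the two levels differ, the upwind water comes from the higher cell, which [dry] empties; if
   they agree, the level difference itself is zero. *)
case: ltgtP => [/dry ->|/dry ->|->]; last by rewrite subrr mulr0 !mul0r.
all: by rewrite !(mulr0, mul0r).
Qed.

Lemma rest_stationary (R : realType) (M : mesh R) (P : parameters M)
    (U : state M) :
  (forall k, velocity U k = 0) ->
  (forall k l, free_surface P U l < free_surface P U k -> depth U k = 0) ->
  stationary_point P U.
Proof.
move=> v0 dry t i; split=> [|a]; (split; first exact: derivable_cst).
  rewrite derive1_cst mulr0 add0r /mass_flux big1 // => j _.
  by rewrite itf_normal_velocity_rest // mulr0.
rewrite derive1_cst mulr0 add0r surface_gradient_rest // addr0 v0 mxE mulr0.
rewrite oppr0 /momentum_flux big1 // => j _.
by rewrite itf_normal_velocity_rest // mulr0.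
Qed.

Theorem proposition4p4 (R : realType) (M : mesh R) (P : parameters M) (w : R) :
  (forall U : state M,
     (forall i, 0 < depth U i) ->
     (forall i, free_surface P U i = w) ->
     (forall i, velocity U i = 0) ->
     stationary_point P U) /\
  (forall (U : state M) (I : {set 'I_(ncells M)}),
     (forall i, velocity U i = 0) ->
     (forall i, i \in I -> free_surface P U i = w) ->
     (forall i, i \notin I ->
        depth U i = 0 /\ w < gravity P * altitude P i) ->
     stationary_point P U).
Proof.
split=> [U _ wE v0|U I v0 wE dry]; apply: rest_stationary => // k l.
  (* With a single common level no cell lies strictly above another. *)
  by rewrite !wE ltxx.
(* A cell outside [I] is dry by assumption. A cell of [I] has level [w], and it remains to exclude
   any cell [l] below it. *)
have [kI|/dry[]//] := boolP (k \in I); rewrite (wE k kI).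
have [/wE->|/dry[hl wl]] := boolP (l \in I); first by rewrite ltxx.
(* The level of a dry cell is that of its soil, here above [w]. *)
by rewrite /free_surface hl addr0 => /(lt_trans wl); rewrite ltxx.
Qed.
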